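(* For every independence logic formula $\phi$ there is an inclusion/exclusion logic formula $\phi'$ equivalent to it, and for every inclusion/exclusion logic formula $\phi$ there is an independence logic formula $\phi'$ equivalent to it, where $\phi$ and $\phi'$ are equivalent if $M\models_X\phi \Leftrightarrow M\models_X\phi'$ for all models $M$ of the relevant signature and all teams $X$ over $M$ whose domain contains the free variables of both formulas.
   Context: All first order models are assumed to have at least two elements in their domain; $\mathrm{Dom}(M)$ is the domain of $M$. An assignment over $M$ is a function from a set of variables to $\mathrm{Dom}(M)$; $s[m/x]$ is the assignment which sends $x$ to $m$ and otherwise agrees with $s$; $t\langle s\rangle$ is the value of the term $t$ in $M$ under $s$, and $\vec t\langle s\rangle$ is the corresponding tuple of values. A team $X$ over $M$ is a set of assignments over $M$ all having the same domain, called the domain of $X$. All formulas are in negation normal form and are built using $\wedge,\vee,\exists x,\forall x$ from first order literals together with: for independence logic, independence atoms $\vec t_2 ~\bot_{\vec t_1}~ \vec t_3$ (finite, possibly empty, tuples of terms, not necessarily of the same length); for inclusion/exclusion logic, inclusion atoms $\vec t_1 \subseteq \vec t_2$ and exclusion atoms $\vec t_1 ~|~ \vec t_2$ (with $\vec t_1,\vec t_2$ finite tuples of terms of the same length). The satisfaction relation $M\models_X\phi$ (lax team semantics), where the domain of $X$ contains the free variables of $\phi$, is: - for a first order literal $\phi$: $M\models_s\phi$ (Tarski) for all $s\in X$; - $M\models_X \vec t_2 ~\bot_{\vec t_1}~ \vec t_3$ iff for all $s,s'\in X$ with $\vec t_1\langle s\rangle=\vec t_1\langle s'\rangle$ there is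 $s''\in X$ with $\vec t_1\langle s''\rangle\vec t_2\langle s''\rangle=\vec t_1\langle s\rangle\vec t_2\langle s\rangle$ and $\vec t_1\langle s''\rangle\vec t_3\langle s''\rangle=\vec t_1\langle s'\rangle\vec t_3\langle s'\rangle$; - $M\models_X \vec t_1\subseteq\vec t_2$ iff for every $s\in X$ there is $s'\in X$ with $\vec t_1\langle s\rangle=\vec t_2\langle s'\rangle$; - $M\models_X \vec t_1~|~\vec t_2$ iff for all $s,s'\in X$, $\vec t_1\langle s\rangle\neq\vec t_2\langle s'\rangle$; - $M\models_X\psi\vee\theta$ iff $X=Y\cup Z$ for some teams $Y,Z$ with $M\models_Y\psi$ and $M\models_Z\theta$; - $M\models_X\psi\wedge\theta$ iff $M\models_X\psi$ and $M\models_X\theta$; - $M\models_X\exists x\psi$ iff there is $H:X\to\mathcal P(\mathrm{Dom}(M))\setminus\{\emptyset\}$ with $M\models_{X[H/x]}\psi$, where $X[H/x]=\{s[m/x]:s\in X,\ m\in H(s)\}$; - $M\models_X\forall x\psi$ iff $M\models_{X[M/x]}\psi$, where $X[M/x]=\{s[m/x]:s\in X,\ m\in\mathrm{Dom}(M)\}$. *)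

(* Defs.v *)
From mathcomp Require Import all_boot.
From mathcomp Require Import boolp classical_sets.

Set Implicit Arguments.
Unset Strict Implicit.
Unset Printing Implicit Defensive.

Local Open Scope classical_set_scope.

Record signature := Signature {
  fun_sym : Type;
  rel_sym : Type;
  fun_arity : fun_sym -> nat;
  rel_arity : rel_sym -> nat
}.

Record model (S : signature) := Model {
  dom :> Type;
  fun_interp : forall f : fun_sym S, (fun_arity f).-tuple dom -> dom;
  rel_interp : forall r : rel_sym S, set ((rel_arity r).-tuple dom);
  dom_two : exists a b : dom, a <> b
}.

(* Variables are natural numbers. *)
Inductive term (S : signature) :=
| Var of nat
| Fun (f : fun_sym S) of ('I_(fun_arity f) -> term S).

Fixpoint term_vars S (t : term S) : set nat :=
  match t with
  | Var x => [set x]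
  | Fun f ts => \bigcup_i term_vars (ts i)
  end.

Definition seq_vars S (ts : seq (term S)) : set nat :=
  \big[setU/set0]_(t <- ts) term_vars t.

(* An assignment is a partial function on variables; its domain is the set of
   variables where it is defined. *)
Definition assignment S (M : model S) := nat -> option M.

Definition assignment_dom S (M : model S) (s : assignment M) : set nat :=
  [set x | isSome (s x)].

Definition upd S (M : model S) (s : assignment M) (x : nat) (m : M) :
    assignment M :=
  fun y => if y == x then Some m else s y.

(* X is a team with domain D (any D is allowed for the empty team). *)
Definition is_team S (M : model S) (D : set nat) (X : set (assignment M)) :=
  forall s, X s -> assignment_dom s = D.

(* [:: v 0; ...; v (n - 1)] if all these values are defined, None otherwise:
   pmap drops the undefined ones, and insub then tests that n remain. *)
Definition otuple A n (v : 'I_n -> option A) : option (n.-tuple A) :=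
  insub (pmap v (enum 'I_n)).

(* t<s>; it is None exactly when s is undefined at some variable of t. *)
Fixpoint eval S (M : model S) (s : assignment M) (t : term S) : option M :=
  match t with
  | Var x => s x
  | Fun f ts => omap (@fun_interp S M f) (otuple (fun i => eval s (ts i)))
  end.

Definition evals S (M : model S) (s : assignment M) (ts : seq (term S)) :
    seq (option M) :=
  [seq eval s t | t <- ts].

Inductive literal (S : signature) :=
| LEq (t u : term S)
| LNeq (t u : term S)
| LRel (r : rel_sym S) of ('I_(rel_arity r) -> term S)
| LNRel (r : rel_sym S) of ('I_(rel_arity r) -> term S).

Definition literal_vars S (l : literal S) : set nat :=
  match l with
  | LEq t u | LNeq t u => term_vars t `|` term_vars u
  | LRel r ts | LNRel r ts => \bigcup_i term_vars (ts i)
  end.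

Definition literal_sat S (M : model S) (s : assignment M) (l : literal S) :
    Prop :=
  match l with
  | LEq t u => eval s t = eval s u
  | LNeq t u => eval s t <> eval s u
  | LRel r ts =>
      exists2 v, otuple (fun i => eval s (ts i)) = Some v & rel_interp v
  | LNRel r ts =>
      exists2 v, otuple (fun i => eval s (ts i)) = Some v & ~ rel_interp v
  end.

(* The two logics differ only in their non-first-order atoms, so formulas are
   parametrized by a kind of atoms. *)
Record atoms (S : signature) := Atoms {
  atom :> Type;
  atom_vars : atom -> set nat;
  atom_sat : forall M : model S, set (assignment M) -> atom -> Prop
}.

Inductive formula S (K : atoms S) :=
| Lit of literal S
| Atom of K
| And of formula K & formula K
| Or of formula K & formula K
| Ex of nat & formula K
| All of nat & formula K.

Fixpoint free_vars S (K : atoms S) (phi : formula K) : set nat :=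
  match phi with
  | Lit l => literal_vars l
  | Atom a => atom_vars a
  | And psi theta | Or psi theta => free_vars psi `|` free_vars theta
  | Ex x psi | All x psi => free_vars psi `\` [set x]
  end.

(* X[H/x]; only the values of H on X matter. *)
Definition supplement S (M : model S) (X : set (assignment M))
    (H : assignment M -> set M) (x : nat) : set (assignment M) :=
  [set s' | exists s m, [/\ X s, H s m & s' = upd s x m]].

Definition duplicate S (M : model S) (X : set (assignment M)) (x : nat) :
    set (assignment M) :=
  [set s' | exists s m, X s /\ s' = upd s x m].

(* Lax team semantics. It is meaningful when X is a team whose domain contains
   the free variables of phi; all the subteams below are then teams too. *)
Fixpoint sat S (K : atoms S) (M : model S) (X : set (assignment M))
    (phi : formula K) : Prop :=
  match phi with
  | Lit l => forall s, X s -> literal_sat s l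
  | Atom a => atom_sat X a
  | And psi theta => sat X psi /\ sat X theta
  | Or psi theta =>
      exists Y Z : set (assignment M), [/\ X = Y `|` Z, sat Y psi & sat Z theta]
  | Ex x psi =>
      exists H : assignment M -> set M,
        (forall s, X s -> H s !=set0) /\ sat (supplement X H x) psi
  | All x psi => sat (duplicate X x) psi
  end.

(* Indep t1 t2 t3 is the atom t2 _||_{t1} t3. *)
Inductive indep_atom (S : signature) :=
| Indep (t1 t2 t3 : seq (term S)).

Definition indep_vars S (a : indep_atom S) : set nat :=
  let: Indep t1 t2 t3 := a in seq_vars t1 `|` seq_vars t2 `|` seq_vars t3.

Definition indep_sat S (M : model S) (X : set (assignment M))
    (a : indep_atom S) : Prop :=
  let: Indep t1 t2 t3 := a in
  forall s s', X s -> X s' -> evals s t1 = evals s' t1 ->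
  exists s'', [/\ X s'',
    evals s'' t1 ++ evals s'' t2 = evals s t1 ++ evals s t2 &
    evals s'' t1 ++ evals s'' t3 = evals s' t1 ++ evals s' t3].

Inductive incexc_atom (S : signature) :=
| Inc n (t1 t2 : n.-tuple (term S))
| Exc n (t1 t2 : n.-tuple (term S)).

Definition incexc_vars S (a : incexc_atom S) : set nat :=
  match a with
  | Inc _ t1 t2 | Exc _ t1 t2 => seq_vars t1 `|` seq_vars t2
  end.

Definition incexc_sat S (M : model S) (X : set (assignment M))
    (a : incexc_atom S) : Prop :=
  match a with
  | Inc _ t1 t2 => forall s, X s -> exists2 s', X s' & evals s t1 = evals s' t2
  | Exc _ t1 t2 => forall s s', X s -> X s' -> evals s t1 <> evals s' t2
  end.

Definition indep S : atoms S := Atoms (@indep_vars S) (@indep_sat S).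
Definition incexc S : atoms S := Atoms (@incexc_vars S) (@incexc_sat S).

Definition indep_formula S := formula (indep S).
Definition incexc_formula S := formula (incexc S).

Definition equivalent S (K K' : atoms S) (phi : formula K) (phi' : formula K') :
    Prop :=
  forall (M : model S) (D : set nat) (X : set (assignment M)),
    is_team D X -> free_vars phi `<=` D -> free_vars phi' `<=` D ->
    (sat X phi <-> sat X phi').

(* Main.v *)
(* The semantics is compositional and the two logics share their connectives, so
   it suffices to express each atom of one logic in the other. The atoms speak
   about the whole team, so their translations quantify universally over a tuple
   z of candidate values. A disjunction may split the team arbitrarily; for
   independence and exclusion atoms the choice of a disjunct is encoded in a
   quantified variable, and so made to depend on selected values only. *)
Require Import Defs.
From mathcomp Require Import all_boot.
From mathcomp Require Import boolp classical_sets.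

Set Implicit Arguments.
Unset Strict Implicit.
Unset Printing Implicit Defensive.

Local Open Scope classical_set_scope.

Lemma cat_inj T (s1 s2 s3 s4 : seq T) :
  size s1 = size s2 -> s1 ++ s3 = s2 ++ s4 -> s1 = s2 /\ s3 = s4.
Proof.
elim: s1 s2 => [|a s1 IH] [|b s2] //= [sz] [-> e].
by have [-> ->] := IH _ sz e.
Qed.

(** * Terms, fresh variables and blocks of updates *)

Section Terms.
Variables (S : signature) (M : model S).
Implicit Types (s w : assignment M) (t : term S) (ts : seq (term S)).

(** A numerical bound makes all later variables fresh, so that a quantified tuple can be a segment
    of consecutive variables. *)
Fixpoint term_bound (t : term S) : nat :=
  match t with
  | Var x => x.+1
  | Fun f ts => \max_i term_bound (ts i)
  end.

Definition seq_bound ts := \max_(t <- ts) term_bound t.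

Definition vars n k : seq (term S) := map (@Var S) (iota n k).

Lemma size_vars n k : size (vars n k) == k.
Proof. by rewrite size_map size_iota. Qed.

(** Lets [[tuple of ...]] infer the lengths of blocks of variables inside inclusion and exclusion
    atoms. *)
Canonical vars_tuple n k := Tuple (size_vars n k).

Lemma eval_eq s w t :
  (forall y, y < term_bound t -> s y = w y) -> eval s t = eval w t.
Proof.
elim: t => [x|f ts IH] /= sw; first exact: sw.
congr omap; congr otuple; apply: funext => i; apply: IH => y yi.
by apply: sw; apply: leq_trans yi _; apply: leq_bigmax.
Qed.

Lemma evals_eq s w ts :
  (forall y, y < seq_bound ts -> s y = w y) -> evals s ts = evals w ts.
Proof.
rewrite /seq_bound; elim: ts => [|t ts IH] //=; rewrite big_cons => sw.
congr cons; [apply: eval_eq | apply: IH] => y yt; apply: sw;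
  by rewrite leq_max yt ?orbT.
Qed.

Lemma seq_bound_vars n k : seq_bound (vars n k) <= n + k.
Proof.
rewrite /seq_bound /vars big_map.
by apply/bigmax_leqP_seq => y + _; rewrite mem_iota => /andP[].
Qed.

Lemma seq_bound_cat ts ts' :
  seq_bound (ts ++ ts') = maxn (seq_bound ts) (seq_bound ts').
Proof. by rewrite /seq_bound big_cat. Qed.

Lemma evals_cat s ts ts' : evals s (ts ++ ts') = evals s ts ++ evals s ts'.
Proof. exact: map_cat. Qed.

Lemma evals_cat_inj s w ts (a b : seq (option M)) :
  evals s ts ++ a = evals w ts ++ b -> evals s ts = evals w ts /\ a = b.
Proof. by apply: cat_inj; rewrite !size_map. Qed.

(** Quantified variables range over [M], not over [option M], so only a defined value can be matched
    by a candidate tuple. *)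
Lemma eval_defined s t :
  term_vars t `<=` assignment_dom s -> exists m, eval s t = Some m.
Proof.
elim: t => [x|f ts IH] /= sub.
  by have := sub x erefl; rewrite /assignment_dom /=; case: (s x) => // m; exists m.
rewrite /otuple; case: insubP => [v _ _|/negP[]]; first by eexists.
rewrite size_pmap; apply/eqP; rewrite -[RHS]size_enum_ord; apply/eqP.
rewrite -all_count; apply/allP => i _ /=; have [|m -> //] := IH i.
by move=> y yi; apply: sub; exists i.
Qed.

Lemma evals_defined s ts :
  seq_vars ts `<=` assignment_dom s -> exists ms, evals s ts = map Some ms.
Proof.
rewrite /seq_vars; elim: ts => [|t ts IH]; first by exists [::].
rewrite big_cons subUset => -[/eval_defined[m em] /IH[ms ems]].
by exists (m :: ms); rewrite /= em ems.
Qed.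

(* [ext s n ms] is s[ms/x_n x_(n+1) ...]. *)
Fixpoint ext s n (ms : seq M) : assignment M :=
  if ms is m :: ms' then ext (upd s n m) n.+1 ms' else s.

Lemma ext_lt s n ms y : y < n -> ext s n ms y = s y.
Proof.
elim: ms s n => [|m ms IH] //= s n yn.
by rewrite IH 1?ltnW // /upd ltn_eqF.
Qed.

Lemma ext_cat s n p q : ext s n (p ++ q) = ext (ext s n p) (n + size p) q.
Proof. by elim: p s n => [|m p IH] s n /=; rewrite ?addn0 // IH addSnnS. Qed.

Lemma evals_ext s n ms ts :
  seq_bound ts <= n -> evals (ext s n ms) ts = evals s ts.
Proof.
by move=> tn; apply: evals_eq => y yt; apply: ext_lt; apply: leq_trans yt tn.
Qed.

Lemma evals_ext_vars s n ms :
  evals (ext s n ms) (vars n (size ms)) = map Some ms.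
Proof.
elim: ms s n => [|m ms IH] //= s n.
by rewrite [ext _ _ _ _]ext_lt // /upd eqxx; congr cons; exact: IH.
Qed.

Lemma evals_ext_varsl s n p q k : size p = k ->
  evals (ext s n (p ++ q)) (vars n k) = map Some p.
Proof. by move=> <-; rewrite ext_cat evals_ext ?evals_ext_vars ?seq_bound_vars. Qed.

Lemma evals_ext_varsr s n p q k l : size p = k -> size q = l ->
  evals (ext s n (p ++ q)) (vars (n + k) l) = map Some q.
Proof. by move=> <- <-; rewrite ext_cat evals_ext_vars. Qed.

(** The layout shared by the translations of independence and exclusion atoms: a reference value
    [c], a candidate tuple [r], then the existential choices [q]. *)
Lemma evals_row s n c r q k (w := ext s n ((c :: r) ++ q)) : size r = k ->
  [/\ evals w (vars n k.+1) = map Some (c :: r), w n = Some c,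
      evals w (vars n.+1 k) = map Some r &
      evals w (vars (n + k.+1) (size q)) = map Some q].
Proof.
move=> <-; have pE : evals w (vars n (size r).+1) = map Some (c :: r).
  exact: evals_ext_varsl.
by rewrite evals_ext_varsr //; move: (pE) => [-> ->].
Qed.

End Terms.

Arguments vars : simpl never.
Arguments ext : simpl never.

(** * Flat formulas and quantifier blocks *)

Section Formulas.
Variables (S : signature) (K : atoms S).
Implicit Types (phi psi : formula K) (ts us : seq (term S)).

Fixpoint AllL n k phi :=
  if k is k'.+1 then All n (AllL n.+1 k' phi) else phi.

Fixpoint ExL n k phi :=
  if k is k'.+1 then Ex n (ExL n.+1 k' phi) else phi.

(* The variable c only serves to write the empty conjunction and disjunction. *)
Fixpoint EqL c ts us : formula K :=
  match ts, us with
  | t :: ts', u :: us' => And (Lit K (LEq t u)) (EqL c ts' us')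
  | _, _ => Lit K (LEq (Var S c) (Var S c))
  end.

Fixpoint NeqL c ts us : formula K :=
  match ts, us with
  | t :: ts', u :: us' => Or (Lit K (LNeq t u)) (NeqL c ts' us')
  | _, _ => Lit K (LNeq (Var S c) (Var S c))
  end.

Variable M : model S.
Implicit Types (s w : assignment M) (X Y : set (assignment M)).

(** Flatness in the sense of team semantics, with the pointwise meaning [P] made explicit. *)
Definition flat phi (P : assignment M -> Prop) :=
  forall X, sat X phi <-> forall s, X s -> P s.

Lemma flat_lit l : flat (Lit K l) (fun s => literal_sat s l).
Proof. by []. Qed.

Lemma flat_and phi psi P Q : flat phi P -> flat psi Q ->
  flat (And phi psi) (fun s => P s /\ Q s).
Proof.
move=> fP fQ X /=; rewrite fP fQ; split=> [[XP XQ] s Xs|XPQ].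
  by split; [apply: XP | apply: XQ].
by split=> s /XPQ[].
Qed.

Lemma flat_or phi psi P Q : flat phi P -> flat psi Q ->
  flat (Or phi psi) (fun s => P s \/ Q s).
Proof.
move=> fP fQ X /=; split=> [[Y [Z [-> /fP YP /fQ ZQ]]] s [/YP|/ZQ]|XPQ].
- by left.
- by right.
exists [set s | X s /\ P s], [set s | X s /\ Q s]; split.
- apply/seteqP; split=> [s Xs|s [[]|[]]] //.
  by have [] := XPQ s Xs; [left | right].
- by apply/fP => s [].
- by apply/fQ => s [].
Qed.

Lemma flat_iff phi P Q : flat phi P -> (forall s, P s <-> Q s) -> flat phi Q.
Proof. by move=> fP PQ; rewrite (_ : Q = P) //; apply/predeqP => s; rewrite PQ. Qed.

Lemma flat_EqL c ts us : size ts = size us ->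
  flat (EqL c ts us) (fun s => evals s ts = evals s us).
Proof.
elim: ts us => [|t ts IH] [|u us] //= [sz].
apply: flat_iff (flat_and (flat_lit _) (IH _ sz)) _ => s /=.
by split=> [[-> ->]|[]].
Qed.

Lemma flat_NeqL c ts us : size ts = size us ->
  flat (NeqL c ts us) (fun s => evals s ts <> evals s us).
Proof.
elim: ts us => [|t ts IH] [|u us] //=;
  first by move=> _ X; split=> h s Xs; have := h s Xs.
move=> [sz]; apply: flat_iff (flat_or (flat_lit _) (IH _ sz)) _ => s /=.
split=> [[ne|ne] [] //|ne].
by apply/not_andP => -[et es]; apply: ne; rewrite et; congr cons.
Qed.

Lemma sat_AllL X n k phi :
  sat X (AllL n k phi) <->
  sat [set w | exists s p, [/\ X s, size p = k & w = ext s n p]] phi.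
Proof.
elim: k X n => [|k IH] X n.
  rewrite (_ : [set w | _] = X) //; apply/seteqP; split=> w.
    by move=> [s [p [Xs /size0nil-> ->]]].
  by move=> Xw; exists w, [::].
rewrite [sat _ _]/= IH.
rewrite (_ : [set w | _] =
  [set w | exists s p, [/\ X s, size p = k.+1 & w = ext s n p]]) //.
apply/seteqP; split=> w.
  move=> [_ [p [[s [m [Xs ->]]] sp ->]]].
  by exists s, (m :: p); rewrite /= sp.
move=> [s [[|m p] [Xs // [sp] ->]]].
by exists (upd s n m), p; split=> //; exists s, m.
Qed.

(** Trading the choice function for the team it produces makes quantifiers easy to compose; [H] is
    recovered by collecting the values that lead into [Y]. *)
Lemma sat_Ex X x phi :
  sat X (Ex x phi) <->
  exists Y, [/\ Y `<=` duplicate X x, forall s, X s -> exists m, Y (upd s x m)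
              & sat Y phi].
Proof.
split=> /= [[H [H0 XH]]|[Y [YX XY Yphi]]].
  exists (supplement X H x); split=> //.
    by move=> _ [s [m [Xs _ ->]]]; exists s, m.
  by move=> s Xs; have [m Hm] := H0 _ Xs; exists m, s, m.
exists (fun s => [set m | Y (upd s x m)]); split; first exact: XY.
rewrite (_ : supplement _ _ _ = Y) //; apply/seteqP; split=> w.
  by move=> [s [m [_ Ym ->]]].
by move=> Yw; have [s [m [Xs ew]]] := YX _ Yw; exists s, m; rewrite /= -ew.
Qed.

Lemma sat_ExL X n k phi :
  sat X (ExL n k phi) <->
  exists Y, [/\ Y `<=` [set w | exists s q, [/\ X s, size q = k & w = ext s n q]],
    forall s, X s -> exists2 q, size q = k & Y (ext s n q) & sat Y phi].
Proof.
elim: k X n => [|k IH] X n.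
  split=> [Xphi|[Y [YX XY Yphi]]].
    exists X; split=> // [w Xw|s Xs]; first by exists w, [::].
    by exists [::].
  rewrite (_ : X = Y) //; apply/seteqP; split=> w.
    by move=> /XY[q /size0nil->].
  by move=> /YX[s [q [Xs /size0nil-> ->]]].
rewrite [ExL _ _ _]/= sat_Ex; split.
  move=> [Y [YX XY /IH[Z [ZY YZ Zphi]]]]; exists Z; split=> //.
    move=> w /ZY[_ [q [/YX[s [m [Xs ->]]] sq ->]]].
    by exists s, (m :: q); rewrite /= sq.
  move=> s /XY[m /YZ[q sq Zq]].
  by exists (m :: q); rewrite /= ?sq.
move=> [Z [ZX XZ Zphi]].
(* The team after the first variable: the updates that some [q] still completes to a member of
   [Z]. *)
exists [set w | exists s m, [/\ X s, w = upd s n m &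
  exists2 q, size q = k & Z (ext w n.+1 q)]]; split.
- by move=> w [s [m [Xs -> _]]]; exists s, m.
- move=> s Xs; have [[|m q] // [sq] Zq] := XZ _ Xs.
  by exists m, s, m; split=> //; exists q.
apply/IH; exists Z; split=> //.
- move=> w Zw; have [s [[|m q] [Xs // [sq] ew]]] := ZX _ Zw.
  exists (upd s n m), q; split=> //.
  by exists s, m; split=> //; exists q => //; rewrite -[ext _ _ _]ew.
- by move=> _ [s [m [Xs -> [q sq Zq]]]]; exists q.
Qed.

(** [R] acts as a multivalued Skolem function: the choices [q] may depend on the assignment [s] and
    on the universal values [p]. *)
Definition rows X n k l (R : assignment M -> seq M -> seq M -> Prop) :=
  [set w | exists s p q,
    [/\ X s, size p = k, size q = l, R s p q & w = ext s n (p ++ q)]].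

Lemma sat_AllL_ExL X n k l phi :
  sat X (AllL n k (ExL (n + k) l phi)) <->
  exists R : assignment M -> seq M -> seq M -> Prop,
    (forall s p, X s -> size p = k -> exists2 q, size q = l & R s p q) /\
    sat (rows X n k l R) phi.
Proof.
rewrite sat_AllL sat_ExL; split.
  move=> [Y [YX XY Yphi]].
  exists (fun s p q => Y (ext s n (p ++ q))); split.
    move=> s p Xs sp; have [|q sq Yq] := XY (ext s n p); first by exists s, p.
    by exists q; rewrite // ext_cat sp.
  rewrite (_ : rows _ _ _ _ _ = Y) //; apply/seteqP; split=> w.
    by move=> [s [p [q [_ _ _ Yq ->]]]].
  move=> Yw; have [_ [q [[s [p [Xs sp ->]]] sq ew]]] := YX _ Yw.
  exists s, p, q; rewrite ext_cat sp.
  by rewrite -ew; split.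
move=> [R [R0 Rphi]]; exists (rows X n k l R); split=> //.
  move=> _ [s [p [q [Xs sp sq _ ->]]]].
  exists (ext s n p), q; split=> //; last by rewrite ext_cat sp.
  by exists s, p.
move=> _ [s [p [Xs sp ->]]]; have [q sq Rq] := R0 _ _ Xs sp.
by exists q => //; exists s, p, q; rewrite ext_cat sp.
Qed.

Lemma rows_or X n k l R R' :
  rows X n k l (fun s p q => R s p q \/ R' s p q) =
  rows X n k l R `|` rows X n k l R'.
Proof.
apply/seteqP; split=> w.
  by move=> [s [p [q [Xs sp sq [r|r] ->]]]]; [left|right]; exists s, p, q.
by move=> [|] [s [p [q [Xs sp sq r ->]]]]; exists s, p, q; split=> //; [left|right].
Qed.

End Formulas.

(** * Reduction to atoms *)

Section Equivalence.
Variable S : signature.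
Implicit Types (K : atoms S).

Lemma is_team_duplicate (M : model S) D (X : set (assignment M)) x :
  is_team D X -> is_team (D `|` [set x]) (duplicate X x).
Proof.
move=> XD _ [s [m [Xs ->]]]; rewrite -(XD s Xs) /assignment_dom /upd.
apply/seteqP; split=> y /=; case: eqP; by [right|left|move=> ? []].
Qed.

Lemma is_team_sub (M : model S) D (X Y : set (assignment M)) :
  is_team D X -> Y `<=` X -> is_team D Y.
Proof. by move=> XD YX s /YX/XD. Qed.

(** Structural induction works because each connective passes to subsets of [X] or of
    [duplicate X x], which are again teams with a domain large enough for the subformulas and their
    translations. *)
Lemma atomwise_equivalent K K' :
  (forall a : K, exists phi' : formula K', equivalent (Atom a) phi') ->
  forall phi : formula K, exists phi' : formula K', equivalent phi phi'.
Proof.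
have sub (A D : set nat) x : A `\` [set x] `<=` D -> A `<=` D `|` [set x].
  by move=> AD y Ay; have [->|yx] := EM (y = x); [right|left; apply: AD].
move=> Ka; elim=> [l|a|f [f' ff'] g [g' gg']|f [f' ff'] g [g' gg']
  |x f [f' ff']|x f [f' ff']].
- by exists (Lit K' l).
- exact: Ka.
- exists (And f' g') => M D X XD /=; rewrite !subUset => -[fD gD] [fD' gD'].
  by rewrite (ff' _ _ _ XD) // (gg' _ _ _ XD).
- exists (Or f' g') => M D X XD /=; rewrite !subUset => -[fD gD] [fD' gD'].
  have eqYZ Y Z : X = Y `|` Z -> sat Y f = sat Y f' /\ sat Z g = sat Z g'.
    move=> eX; split; apply: propext; [apply: ff' fD fD' | apply: gg' gD gD'];
      by apply: is_team_sub XD _; rewrite eX => s; first [by left | by right].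
  split=> -[Y [Z [eX Yf Zg]]]; exists Y, Z; have [ef eg] := eqYZ _ _ eX.
    by rewrite -ef -eg.
  by rewrite ef eg.
- exists (Ex x f') => M D X XD fD fD'; rewrite !sat_Ex.
  have eqY Y : Y `<=` duplicate X x -> sat Y f = sat Y f'.
    move=> YX; apply: propext; apply: ff' (sub _ _ _ fD) (sub _ _ _ fD').
    exact: is_team_sub (is_team_duplicate XD) YX.
  split=> -[Y [YX XY Yf]]; exists Y; split=> //.
    by rewrite -eqY.
  by rewrite eqY.
- exists (All x f') => M D X XD fD fD' /=.
  exact: ff' (is_team_duplicate XD) (sub _ _ _ fD) (sub _ _ _ fD').
Qed.

Lemma dom_neq (M : model S) (c : M) : exists d : M, d <> c.
Proof.
have [a [b ab]] := dom_two M; have [<-|ac] := EM (a = c); last by exists a.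
by exists b => ba; apply: ab.
Qed.

(** * Independence atoms in inclusion/exclusion logic *)

Section Indep.
Variables t1 t2 t3 : seq (term S).
Let n := seq_bound (t1 ++ t2 ++ t3).
Let k := size t3.
Let x := (n + k.+1)%N.

Definition indep_exc : incexc_atom S :=
  Exc [tuple of in_tuple t1 ++ vars S n k.+1 ++ [:: Var S x]]
      [tuple of in_tuple t1 ++ vars S n k.+1 ++ [:: Var S x.+1]].

Definition indep_inc : incexc_atom S :=
  Inc [tuple of in_tuple t1 ++ in_tuple t2 ++ vars S n.+1 k]
      [tuple of in_tuple t1 ++ in_tuple t2 ++ in_tuple t3].

(* With c = x_n, z = x_(n+1) ... x_(n+k) and y = x.+1, this is
   A c z E x y (t1 c z x | t1 c z y /\
     ((x = c /\ z <> t3) \/ (y = c /\ t1 t2 z <= t1 t2 t3))):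
   the exclusion atom makes the choice of the disjunct depend only on the
   values of t1, c and z. *)
Definition indep_incexc : incexc_formula S :=
  AllL n k.+1 (ExL x 2 (And (Atom (K := incexc S) indep_exc)
    (Or (And (Lit _ (LEq (Var S x) (Var S n))) (NeqL _ n (vars S n.+1 k) t3))
        (And (Lit _ (LEq (Var S x.+1) (Var S n)))
             (Atom (K := incexc S) indep_inc))))).

(** Given independence, the second disjunct receives the rows whose [z] is a value of [t3] attained
    with the same [t1]. Conversely, for [z] equal to [t3] at [s'], the row of [s'] is forced there,
    the exclusion atom pulls the row of [s] along, and the inclusion atom yields the witness. *)
Lemma indep_incexcP :
  equivalent (Atom (K := indep S) (Indep t1 t2 t3)) indep_incexc.
Proof.
have [n1 n2 n3] : [/\ seq_bound t1 <= n, seq_bound t2 <= n & seq_bound t3 <= n].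
  by rewrite /n !seq_bound_cat !leq_max !leqnn !orbT.
have sz : size (vars S n.+1 k) = size t3 by exact: (eqP (size_vars _ _ _)).
move=> M D X XD aD _.
have {aD} t3D : seq_vars t3 `<=` D by move: aD; rewrite /= !subUset => -[].
rewrite /indep_incexc sat_AllL_ExL [sat _ (Atom _)]/=.
have E1 (s : assignment M) ms := evals_ext s ms n1.
have E2 (s : assignment M) ms := evals_ext s ms n2.
have E3 (s : assignment M) ms := evals_ext s ms n3.
have rowP (s : assignment M) c r a b (w := ext s n ((c :: r) ++ [:: a; b])) :
    size r = k ->
    [/\ evals w (vars S n k.+1) = map Some (c :: r), w n = Some c,
        evals w (vars S n.+1 k) = map Some r, w x = Some a & w x.+1 = Some b].
  by rewrite /w => /(evals_row s n c [:: a; b])[-> -> -> [-> ->]].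
split=> [ind|].
  pose P s (r : seq M) := exists s', [/\ X s', evals s t1 = evals s' t1 &
    evals s' t3 = map Some r].
  (* The value [c] in [x] or in [y] marks the disjunct; the other variable is kept different from
     [c] for the sake of the exclusion atom. *)
  pose R1 s p q := exists c r a b,
    [/\ p = c :: r, q = [:: a; b] & [/\ ~ P s r, a = c & b <> c]].
  pose R2 s p q := exists c r a b,
    [/\ p = c :: r, q = [:: a; b] & [/\ P s r, a <> c & b = c]].
  exists (fun s p q => R1 s p q \/ R2 s p q); split.
    move=> s [//|c r] Xs _; have [d dc] := dom_neq c.
    have [Psr|nPsr] := EM (P s r).
      by exists [:: d; c] => //; right; exists c, r, d, c.
    by exists [:: c; d] => //; left; exists c, r, c, d.
  rewrite rows_or /=; split; last first.
    exists (rows X n k.+1 2 R1), (rows X n k.+1 2 R2); split=> //.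
      split=> [w|]; last apply/(flat_NeqL _ n sz) => w;
      move=> [s [p [q [Xs sp _ [c [r [a [b [ep -> [nP -> bc]]]]]] ->]]]];
      move: sp; rewrite ep => -[sr];
      have [_ cE zE xE _] := rowP s c r c b sr.
        by rewrite xE cE.
      rewrite zE evals_ext // => e3.
      by apply: nP; exists s.
    split=> w [s [p [q [Xs sp _ [c [r [a [b [ep -> [Ps ac ->]]]]]] ->]]]];
      move: sp; rewrite ep => -[sr];
      have [_ cE zE xE yE] := rowP s c r a c sr.
      by rewrite yE cE.
    have [s' [Xs' e1 e3]] := Ps.
    have [s2 [Xs2 e12 e13]] := ind _ _ Xs Xs' e1.
    have [e1' e2'] := evals_cat_inj e12.
    have [_ e3'] := evals_cat_inj e13.
    (* The same candidate and choices over [s2] stay in [R2], because [P] sees only the value of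
       [t1]. *)
    exists (ext s2 n ((c :: r) ++ [:: a; c])).
      exists s2, (c :: r), [:: a; c]; split=> //; first by rewrite /= sr.
      exists c, r, a, c; split=> //; split=> //.
      by exists s'; split=> //; rewrite e1'.
    by rewrite /= !evals_cat E1 E1 E2 E2 E3 zE e1' e2' e3' e3.
  have rowR w : rows X n k.+1 2 R1 w \/ rows X n k.+1 2 R2 w ->
    exists s c r a b, [/\ w = ext s n ((c :: r) ++ [:: a; b]), size r = k &
      [/\ ~ P s r, a = c & b <> c] \/ [/\ P s r, a <> c & b = c]].
    by case=> -[s [p [q [Xs sp _ [c [r [a [b [ep -> H]]]]] ->]]]];
      exists s, c, r, a, b; rewrite -ep; move: sp; rewrite ep => -[sr];
      split=> //; first [by left | by right].
  move=> w w' /rowR[s [c [r [a [b [-> sr H]]]]]].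
  move=> /rowR[s' [c' [r' [a' [b' [-> sr' H']]]]]].
  have [cE _ _ aE _] := rowP s c r a b sr.
  have [cE' _ _ _ bE'] := rowP s' c' r' a' b' sr'.
  rewrite -!cat_cons -[Var S n :: _]/(vars S n k.+1) !evals_cat !E1 cE cE' /=.
  rewrite aE bE' => /cat_inj.
  rewrite !size_map => -[] // e1 [ec].
  move=> /cat_inj[]; first by rewrite !size_map sr.
  move=> /(inj_map (@Some_inj _)) er [eab].
  (* Equal [t1] and [z] put both rows on the same side of [P], where exactly one of [x] and [y]
     equals [c]. *)
  have eP : P s r = P s' r by rewrite /P e1.
  by move: H H'; rewrite -ec -er -eab -eP => -[[nP ac _]|[P' ac _]] [[]|[]].
move=> [R [R0 /= [exc [Y [Z [eR [Yx Yz] [Zy Zinc]]]]]]] s s' Xs Xs' e1.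
have [r er] : exists r, evals s' t3 = map Some r.
  by apply: evals_defined; rewrite (XD _ Xs').
have sr : size r = k.
  by have := congr1 size er; rewrite !size_map.
(* Any element serves as reference value, as long as both rows share it. *)
have [c [_ _]] := dom_two M.
have rowY s1 : X s1 -> exists a b (w := ext s1 n ((c :: r) ++ [:: a; b])),
    rows X n k.+1 2 R w /\ (Y w \/ Z w).
  move=> Xs1; have [||[|a [|b []]] // _ Rq] := R0 s1 (c :: r) => //=.
    by rewrite sr.
  exists a, b; rewrite -[_ \/ _]/((Y `|` Z) _) -eR.
  by split; exists s1, (c :: r), [:: a; b]; rewrite /= sr.
have [a [b [Rw YZ]]] := rowY _ Xs.
have [a' [b' [Rw' YZ']]] := rowY _ Xs'.
have [cE cE1 zE aE bE] := rowP s c r a b sr.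
have [cE' cE1' zE' aE' bE'] := rowP s' c r a' b' sr.
have {YZ'} Zw' : Z (ext s' n ((c :: r) ++ [:: a'; b'])).
  case: YZ' => // /(proj1 (flat_NeqL _ n sz _) Yz)[].
  by rewrite E3 zE'.
have {YZ} Zw : Z (ext s n ((c :: r) ++ [:: a; b])).
  (* In the first disjunct [x = c] over [s], while [y = c] over [s']: the exclusion atom forbids
     this for equal [t1], [c] and [z]. *)
  case: YZ => // /Yx xc; have := Zy _ Zw' => yc; case: (exc _ _ Rw Rw').
  rewrite -!cat_cons -[Var S n :: _]/(vars S n k.+1) !evals_cat !E1 cE cE' e1.
  by rewrite /= xc yc cE1 cE1'.
have [w Zw2] := Zinc _ Zw.
have : rows X n k.+1 2 R w by rewrite eR; right.
move=> [s2 [p [q [Xs2 _ _ _ ->]]]]; rewrite !evals_cat !E1 !E2 E3 zE -er.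
move=> /evals_cat_inj[e12] /evals_cat_inj[e22 e32].
by exists s2; rewrite -e12 -e22 -e32 e1.
Qed.


End Indep.

(** * Exclusion atoms in independence logic *)

Section Exclusion.
Variables (k : nat) (t1 t2 : k.-tuple (term S)).
Let n := seq_bound (t1 ++ t2).
Let x := (n + k.+1)%N.

(* A c z E x (x _||_{c z} x /\ ((x = c /\ z <> t1) \/ (x <> c /\ z <> t2))):
   the independence atom makes x a function of c and z, so that the choice
   between z <> t1 and z <> t2 depends only on z and c. *)
Definition exc_indep : indep_formula S :=
  AllL n k.+1 (ExL x 1 (And
    (Atom (K := indep S) (Indep (vars S n k.+1) [:: Var S x] [:: Var S x]))
    (Or (And (Lit _ (LEq (Var S x) (Var S n))) (NeqL _ n (vars S n.+1 k) t1))
        (And (Lit _ (LNeq (Var S x) (Var S n))) (NeqL _ n (vars S n.+1 k) t2))))).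

(** Under exclusion, each candidate is missed by [t1] or by [t2] on all of [X], so the disjunct can
    be chosen from it alone. Conversely, a common value would force [x <> c] over [s] and [x = c]
    over [s']. *)
Lemma exc_indepP : equivalent (Atom (K := incexc S) (Exc t1 t2)) exc_indep.
Proof.
have [n1 n2] : seq_bound t1 <= n /\ seq_bound t2 <= n.
  by rewrite /n seq_bound_cat !leq_max !leqnn orbT.
have sz (t : k.-tuple (term S)) : size (vars S n.+1 k) = size t.
  by rewrite !size_tuple.
move=> M D X XD aD _.
have {aD} t1D : seq_vars t1 `<=` D by move: aD; rewrite /= subUset => -[].
rewrite /exc_indep sat_AllL_ExL [sat _ (Atom _)]/=.
have E1 (s : assignment M) ms := evals_ext s ms n1.
have E2 (s : assignment M) ms := evals_ext s ms n2.
have rowP (s : assignment M) c r a (w := ext s n ((c :: r) ++ [:: a])) :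
    size r = k ->
    [/\ evals w (vars S n k.+1) = map Some (c :: r), w n = Some c,
        evals w (vars S n.+1 k) = map Some r & w x = Some a].
  by rewrite /w => /(evals_row s n c [:: a])[-> -> -> [->]].
have flatP := flat_or
  (flat_and (flat_lit _ _) (flat_NeqL (indep S) (M := M) n (sz t1)))
  (flat_and (flat_lit _ (LNeq (Var S x) (Var S n))) (flat_NeqL _ n (sz t2))).
split=> [exc|].
  have [d dc] := choice (@dom_neq M).
  pose P r := exists2 s, X s & evals s t1 = map Some r.
  (* [d c] differs from [c], so [x = c] marks the candidates that [t1] never takes on [X]. *)
  pose f c r := if `[< P r >] then d c else c.
  exists (fun s p q => exists c r, p = c :: r /\ q = [:: f c r]); split.
    by move=> s [//|c r] Xs _; exists [:: f c r] => //; exists c, r.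
  have rowR w : rows X n k.+1 1
      (fun s p q => exists c r, p = c :: r /\ q = [:: f c r]) w ->
    exists s c r, [/\ X s, w = ext s n ((c :: r) ++ [:: f c r]) & size r = k].
    move=> [s [p [q [Xs sp _ [c [r [ep ->]]] ->]]]]; exists s, c, r.
    by rewrite -ep; move: sp; rewrite ep => -[].
  split; last first.
    apply/flatP => w /rowR[s [c [r [Xs -> sr]]]].
    have [_ cE zE xE] := rowP s c r (f c r) sr.
    rewrite /= cE xE zE E1 E2 /f; case: asboolP => Pr; [right|left]; split=> //.
    - by move=> [] /dc.
    - by move=> e2; have [s' Xs' e1] := Pr; apply: (exc _ _ Xs' Xs); rewrite e1.
    - by move=> e1; apply: Pr; exists s.
  move=> w w' Rw /rowR[s' [c' [r' [_ -> sr']]]].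
  have [s [c [r [_ ew sr]]]] := rowR _ Rw; move: Rw; rewrite ew => Rw.
  have [cE _ _ xE] := rowP s c r (f c r) sr.
  have [cE' _ _ xE'] := rowP s' c' r' (f c' r') sr'.
  rewrite cE cE' => -[ec /(inj_map (@Some_inj _)) er].
  exists (ext s n ((c :: r) ++ [:: f c r])); split; rewrite ?cE //.
  congr (_ ++ [:: _]); first by rewrite ec er.
  by rewrite [LHS]xE [RHS]xE' ec er.
move=> [R [R0 [ind /flatP RP]]] s s' Xs Xs' e12.
have [r er] : exists r, evals s t1 = map Some r.
  by apply: evals_defined; rewrite (XD _ Xs).
have sr : size r = k.
  by have := congr1 size er; rewrite !size_map size_tuple.
have [c [_ _]] := dom_two M.
have rowY s1 : X s1 ->
    exists a, rows X n k.+1 1 R (ext s1 n ((c :: r) ++ [:: a])).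
  move=> Xs1; have [|[|a []] // _ Rq] := R0 s1 (c :: r) Xs1.
    by rewrite /= sr.
  by exists a, s1, (c :: r), [:: a]; rewrite /= sr.
have [a Ra] := rowY _ Xs; have [a' Ra'] := rowY _ Xs'.
have [cE cE1 zE xE] := rowP s c r a sr.
have [cE' cE1' zE' xE'] := rowP s' c r a' sr.
(* The row [w] shares its [x] with both given rows, hence [a = a']. *)
have [w [_]] := ind _ _ Ra Ra' (etrans cE (esym cE')).
rewrite cE cE' => -> /cat_inj[] // _.
case; rewrite [LHS]xE [RHS]xE' => -[aa'].
have := RP _ Ra'; rewrite /= cE1' zE' xE' E1 E2 -e12 er => -[[ac _]|[_ []]] //.
by have := RP _ Ra; rewrite /= cE1 zE xE E1 E2 er aa' ac => -[[_ []]|[[]]].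
Qed.

End Exclusion.

(** * Inclusion atoms in independence logic *)

Section Inclusion.
Variables (k : nat) (t1 t2 : k.-tuple (term S)).
Let n := seq_bound (t1 ++ t2).

(* A v1 v2 z ((z <> t1 /\ z <> t2) \/ (v1 <> v2 /\ z <> t2) \/
     ((v1 = v2 \/ z = t2) /\ z _||_ v1 v2)).
   The rows with v1 = v2 and z = t1, as well as those with z = t2, must satisfy
   the last disjunct; by independence z then takes each value of t1 in a row
   with v1 <> v2, which forces z = t2 there. *)
Definition inc_indep : indep_formula S :=
  let z := vars S n.+2 k in let v1 := Var S n in let v2 := Var S n.+1 in
  AllL n k.+2 (Or (And (NeqL _ n z t1) (NeqL _ n z t2))
    (Or (And (Lit _ (LNeq v1 v2)) (NeqL _ n z t2))
        (And (Or (Lit _ (LEq v1 v2)) (EqL _ n z t2))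
             (Atom (K := indep S) (Indep [::] z [:: v1; v2]))))).

Lemma inc_indepP : equivalent (Atom (K := incexc S) (Inc t1 t2)) inc_indep.
Proof.
have [n1 n2] : seq_bound t1 <= n /\ seq_bound t2 <= n.
  by rewrite /n seq_bound_cat !leq_max !leqnn orbT.
have sz (t : k.-tuple (term S)) : size (vars S n.+2 k) = size t.
  by rewrite !size_tuple.
move=> M D X XD aD _.
have {aD} [t1D t2D] : seq_vars t1 `<=` D /\ seq_vars t2 `<=` D.
  by move: aD; rewrite /= subUset.
rewrite /inc_indep sat_AllL [sat _ (Atom _)]/=.
have E1 (s : assignment M) ms := evals_ext s ms n1.
have E2 (s : assignment M) ms := evals_ext s ms n2.
have rowP (s : assignment M) a b r (w := ext s n [:: a, b & r]) : size r = k ->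
    [/\ w n = Some a, w n.+1 = Some b & evals w (vars S n.+2 k) = map Some r].
  by rewrite /w => <-; have [-> -> ->] := evals_ext_vars s n [:: a, b & r].
have flat1 := flat_and (flat_NeqL (indep S) (M := M) n (sz t1))
  (flat_NeqL _ n (sz t2)).
have flat2 := flat_and (flat_lit _ (LNeq (Var S n) (Var S n.+1)))
  (flat_NeqL (indep S) (M := M) n (sz t2)).
have flat3 := flat_or (flat_lit _ (LEq (Var S n) (Var S n.+1)))
  (flat_EqL (indep S) (M := M) n (sz t2)).
have defined (t : k.-tuple (term S)) s : seq_vars t `<=` D -> X s ->
    exists2 r, size r = k & evals s t = map Some r.
  move=> tD Xs; have [|r er] := @evals_defined _ _ s t; first by rewrite (XD _ Xs).
  by exists r => //; have := congr1 size er; rewrite !size_map size_tuple.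
set T := [set w | _].
have rowT w : T w ->
    exists s a b r, [/\ X s, size r = k & w = ext s n [:: a, b & r]].
  by move=> [s [[|a [|b r]] [Xs // [sr] ->]]]; exists s, a, b, r.
have Trow s a b r : X s -> size r = k -> T (ext s n [:: a, b & r]).
  by move=> Xs sr; exists s, [:: a, b & r]; rewrite /= sr.
split=> [inc|].
  pose Eq (w : assignment M) (t : seq (term S)) :=
    evals w (vars S n.+2 k) = evals w t.
  pose T1 := [set w | T w /\ (~ Eq w t1 /\ ~ Eq w t2)].
  pose T2 := [set w | T w /\ (w n <> w n.+1 /\ ~ Eq w t2)].
  (* Exactly the rows that fit neither of the first two disjuncts. *)
  pose T3 := [set w | T w /\ ((w n = w n.+1 /\ Eq w t1) \/ Eq w t2)].
  exists T1, (T2 `|` T3); split; last 1 first.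
  - exists T2, T3; split=> //; first by apply/flat2 => w [].
    split; first by apply/flat3 => w [_ [[]|]]; [left|right].
    move=> w w' [Tw Tw3] [/rowT[s' [a' [b' [r' [Xs' sr' ->]]]]] _] _.
    have [s [a [b [r [Xs sr ew]]]]] := rowT _ Tw.
    move: Tw3; rewrite /Eq {}ew E1 E2.
    have [_ _ zE] := rowP s a b r sr; have [aE' bE' _] := rowP s' a' b' r' sr'.
    rewrite /= zE aE' bE' => Tw3.
    (* Every candidate in [T3] is a value of [t2] somewhere, by inclusion if it came from [t1]; over
       such an [s2] its row is in [T3] whatever [v1] and [v2] are. *)
    have [s2 Xs2 e2] : exists2 s2, X s2 & map Some r = evals s2 t2.
      case: Tw3 => [[_ ->]|->]; last by exists s.
      exact: inc.
    have [aE2 bE2 zE2] := rowP s2 a' b' r sr.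
    exists (ext s2 n [:: a', b' & r]); rewrite zE2 aE2 bE2; split=> //.
    by split; [apply: Trow | right; rewrite /Eq zE2 E2].
  - apply/seteqP; split=> w; last by case=> [|[|]] [].
    move=> Tw; have [e2|ne2] := EM (Eq w t2).
      by right; right; split=> //; right.
    have [e1|ne1] := EM (Eq w t1); last by left.
    have [ev|nev] := EM (w n = w n.+1); last by right; left.
    by right; right; split=> //; left.
  - by apply/flat1 => w [].
move=> [T1 [T' [eT /flat1 T1P [T2 [T3 [eT' /flat2 T2P [/flat3 T3P ind]]]]]]] s Xs.
have T3row w : T w -> evals w (vars S n.+2 k) = evals w t2 \/
    w n = w n.+1 /\ evals w (vars S n.+2 k) = evals w t1 -> T3 w.
  rewrite eT eT' => -[/T1P[ne1 ne2]|[/T2P[ne ne2]|]] //.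
    by case=> [/ne2|[_ /ne1]].
  by case=> [/ne2|[/ne]].
have [r1 sr1 er1] := defined _ _ t1D Xs; have [r2 sr2 er2] := defined _ _ t2D Xs.
(* The pair [a, a] brings [r1] into [T3], and [r2] brings in the pair [a, b]. Independence combines
   [r1] with [a, b], where only [z = t2] remains possible. *)
have [a [b ab]] := dom_two M.
have [aE bE zE] := rowP s a a r1 sr1; have [aE' bE' zE'] := rowP s a b r2 sr2.
have T3w : T3 (ext s n [:: a, a & r1]).
  by apply: T3row; [apply: Trow | right; rewrite aE bE zE E1].
have T3w' : T3 (ext s n [:: a, b & r2]).
  by apply: T3row; [apply: Trow | left; rewrite zE' E2].
have [w [T3w2]] := ind _ _ T3w T3w' erefl; rewrite /= zE aE' bE' => ez [ea eb].
have : T w by rewrite eT eT'; right; right.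
move=> /rowT[s2 [a2 [b2 [r [Xs2 sr ew]]]]]; exists s2 => //.
have := T3P _ T3w2; rewrite /= ea eb ez ew E2 er1.
by case=> // -[].
Qed.

End Inclusion.

End Equivalence.

Theorem corollary4p23 (S : signature) :
  (forall phi : indep_formula S,
     exists phi' : incexc_formula S, equivalent phi phi') /\
  (forall phi : incexc_formula S,
     exists phi' : indep_formula S, equivalent phi phi').
Proof.
split; apply: atomwise_equivalent.
- by case=> t1 t2 t3; eexists; apply: indep_incexcP.
- by case=> k t1 t2; eexists; [apply: inc_indepP | apply: exc_indepP].
Qed.
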